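(* Let $-1<\alpha<0<\beta<1$, let $\sigma$ be a finite nonnegative measure (with infinite support) on $E=[-1,\alpha]\cup[\beta,1]$, and let $\{\widehat P_j\}_{j=0}^\infty$ be the monic polynomials orthogonal with respect to $\sigma$, $\deg\widehat P_j=j$. Assume that $0$ is not an accumulation point of zeros of a subsequence $\{\widehat P_{j_k}\}_{k=1}^\infty$. Then the sequence \[ \left\{\frac{\widehat P_{j_k+1}(0)}{\widehat P_{j_k}(0)}\right\}_{k=1}^\infty \] is bounded.
   Context: ''$0$ is not an accumulation point of zeros of the subsequence $\{\widehat P_{j_k}\}_{k=1}^\infty$'' means that there is $\delta>0$ such that no polynomial $\widehat P_{j_k}$, $k\ge1$, has a zero in $(-\delta,\delta)$. *)

(* Defs.v *)
From HB Require Import structures.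
From mathcomp Require Import all_boot all_order all_algebra.
From mathcomp Require Import all_classical all_reals all_analysis.
Import Order.TTheory GRing.Theory Num.Theory.
Import numFieldNormedType.Exports.

Set Implicit Arguments.
Unset Strict Implicit.
Unset Printing Implicit Defensive.

Local Open Scope classical_set_scope.
Local Open Scope ring_scope.

Definition two_intervals (R : realType) (alpha beta : R) : set R :=
  `[-1, alpha] `|` `[beta, 1].

Definition msupport (R : realType)
    (mu : {measure set (measurableTypeR R) -> \bar R}) : set R :=
  [set x : R | forall U : set R, open_nbhs x U -> (0 < mu U)%E].

(* The integrals are over E, for a measure mu on R that is concentrated on E.
   When E is compact and mu is finite every polynomial is mu-integrable on E,
   so these integrals are finite. *)
Definition monic_orthogonal (R : realType)
    (mu : {measure set (measurableTypeR R) -> \bar R}) (E : set R)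
    (P : nat -> {poly R}) : Prop :=
  [/\ forall n, P n \is monic,
      forall n, size (P n) = n.+1 &
      forall m n, m != n ->
        (\int[mu]_(x in E) ((P m).[x] * (P n).[x])%:E = 0)%E].

Definition accumulation_free0 (R : realType) (Q : nat -> {poly R}) : Prop :=
  exists2 delta : R, 0 < delta &
    forall k (x : R), x \in `]- delta, delta[ -> ~~ root (Q k) x.

(* Main.v *)
Require Import Defs.
From HB Require Import structures.
From mathcomp Require Import all_boot all_order all_algebra.
From mathcomp Require Import all_classical all_reals all_analysis.
From mathcomp Require Import measurable_realfun finmap ring lra.
Import Order.TTheory GRing.Theory Num.Theory.
Import numFieldNormedType.Exports.
Local Open Scope classical_set_scope.
Local Open Scope ring_scope.

(** Write L p for the integral of a polynomial p over E. Orthogonality, together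
with the positivity of L on nonzero squares (the support of the measure is
infinite), gives the three-term recurrence

    P_(n+1) = ('X - b) P_n - c P_(n-1),

and |b| <= 1, 0 <= c <= 1 because E lies in [-1, 1], so that multiplication by 'X
is a contraction for the norm defined by L ([recurrence]). At 0 this reads
P_(n+1)(0) / P_n(0) = - b - c P_(n-1)(0) / P_n(0): it remains to bound
g(0), where g = P_(n-1) / P_n, when P_n has no zero in (-d, d).

The usual bound on g expands it in partial fractions over the zeros of P_n,
which are real and simple, with positive weights of sum 1. A differential
inequality replaces this expansion. By the recurrence the Wronskian
W_n = P_n' P_(n-1) - P_n P_(n-1)' satisfies W_(n+1) = P_n^2 + c W_n, whence
W_n >= P_(n-1)^2 ([wronskian_ge]), that is g' <= - g^2 wherever P_n does not
vanish. A solution of this Riccati inequality with g(0) != 0 blows up within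
distance 1 / |g(0)| of 0, on one side. As g has no pole in (-d, d), it
follows that |g(0)| <= 1 / d ([ratio_bound]). The ratios P_(n+1)(0) / P_n(0)
are therefore bounded by 1 + 1 / d. *)

Definition wronskian {R : nzRingType} (p q : {poly R}) : {poly R} :=
  p^`() * q - p * q^`().

(** * Orthogonal polynomials for a positive functional *)

Section OrthogonalPolynomials.
(* [Lcontract] abstracts the fact that the functional is an integral over a
   subset of [-1, 1]. *)
Variables (R : realFieldType) (L : {scalar {poly R}}) (P : nat -> {poly R}).
Hypothesis Lpos : forall p : {poly R}, p != 0 -> 0 < L (p * p).
Hypothesis Lcontract : forall p : {poly R}, L ('X * p * ('X * p)) <= L (p * p).
Hypothesis Pmonic : forall n, P n \is monic.
Hypothesis Psize : forall n, size (P n) = n.+1.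
Hypothesis Porth : forall m n, m != n -> L (P m * P n) = 0.

Let LD (p q : {poly R}) : L (p + q) = L p + L q. Proof. exact: linearD. Qed.
Let LB (p q : {poly R}) : L (p - q) = L p - L q. Proof. exact: linearB. Qed.
Let LZ a (p : {poly R}) : L (a *: p) = a * L p. Proof. exact: linearZ. Qed.

Lemma Pcoef n i : (n <= i)%N -> (P n)`_i = (i == n)%:R.
Proof.
rewrite leq_eqVlt => /predU1P[<-|ni].
  by rewrite eqxx; move/monicP: (Pmonic n); rewrite lead_coefE Psize.
by rewrite gtn_eqF// nth_default// Psize.
Qed.

Lemma Pneq0 n : P n != 0. Proof. exact/monic_neq0. Qed.

(** The P_k with k < n form a basis of the polynomials of degree less than n. *)
Lemma orthogonal_to_smaller (u : {poly R}) n :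
  (forall k, (k < n)%N -> L (u * P k) = 0) ->
  forall q : {poly R}, (size q <= n)%N -> L (u * q) = 0.
Proof.
elim: n => [_ q|n IHn uP q sq].
  by rewrite leqn0 size_poly_eq0 => /eqP ->; rewrite mulr0 linear0.
have -> : q = (q - q`_n *: P n) + q`_n *: P n by rewrite subrK.
rewrite mulrDr -scalerAr LD LZ uP// mulr0 addr0.
apply: IHn => [k kn|]; first by rewrite uP// ltnW.
apply/leq_sizeP => i ni; rewrite coefB coefZ Pcoef//.
move: ni; rewrite leq_eqVlt => /predU1P[<-|ni]; first by rewrite eqxx mulr1 subrr.
by rewrite gtn_eqF// mulr0 subr0 nth_default// (leq_trans sq).
Qed.

Lemma orthogonal_lower n (q : {poly R}) : (size q <= n)%N -> L (P n * q) = 0.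
Proof.
by apply: orthogonal_to_smaller => k kn; rewrite Porth// gtn_eqF.
Qed.

Lemma size_mulX_sub n : (size ('X * P n - P n.+1)%R <= n.+1)%N.
Proof.
apply/leq_sizeP => -[//|i] ni.
by rewrite coefB coefXM !Pcoef// eqSS subrr.
Qed.

Lemma L_mulX_succ n : L (P n.+1 * ('X * P n)) = L (P n.+1 * P n.+1).
Proof.
apply/eqP; rewrite -subr_eq0 -LB -mulrBr orthogonal_lower//.
exact: size_mulX_sub.
Qed.

Lemma L_sq_ge0 p : 0 <= L (p * p).
Proof.
by have [->|/Lpos/ltW//] := eqVneq p 0; rewrite mulr0 linear0.
Qed.

(** Expand L (p + 'X p)^2 >= 0 and L (p - 'X p)^2 >= 0. *)
Lemma L_mulX_bound p : `|L ('X * p * p)| <= L (p * p).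
Proof.
have hs := Lcontract p.
have h1 := L_sq_ge0 (p + 'X * p); have h2 := L_sq_ge0 (p - 'X * p).
have e1 : (p + 'X * p) * (p + 'X * p) =
   p * p + 'X * p * ('X * p) + ('X * p * p + 'X * p * p) by ring.
have e2 : (p - 'X * p) * (p - 'X * p) =
   p * p + 'X * p * ('X * p) - ('X * p * p + 'X * p * p) by ring.
rewrite e1 !LD in h1; rewrite e2 LB !LD in h2.
by rewrite ler_norml; apply/andP; split; lra.
Qed.

(** P_(n+1) is the component of 'X P_n orthogonal to degrees at most n, so its
norm is at most that of 'X P_n. *)
Lemma norm_nonincreasing n : L (P n.+1 * P n.+1) <= L (P n * P n).
Proof.
apply: le_trans (Lcontract (P n)).
set s := 'X * P n - P n.+1.
have -> : 'X * P n = P n.+1 + s by rewrite /s addrC subrK.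
have -> : (P n.+1 + s) * (P n.+1 + s) =
  P n.+1 * P n.+1 + (P n.+1 * s + P n.+1 * s) + s * s by ring.
rewrite !LD (orthogonal_lower _ s) ?size_mulX_sub// !addr0 lerDl.
exact: L_sq_ge0.
Qed.

(** P_(n-1), with the convention P_(-1) = 0, under which the recurrence and the
Wronskian inequality also hold at n = 0. *)
Definition Pprev n := if n is m.+1 then P m else 0.

Lemma size_Pprev n : (size (Pprev n) <= n)%N.
Proof. by case: n => [|n] /=; rewrite ?size_poly0 ?Psize. Qed.

(** The coefficients are b = L ('X P_n^2) / L (P_n^2) and
c = L (P_n^2) / L (P_(n-1)^2). The defect r of the recurrence has degree at most
n and is orthogonal to P_0, ..., P_n, hence to itself, so it vanishes by
positivity. *)
Lemma recurrence n : exists b c : R, [/\ `|b| <= 1, 0 <= c <= 1 &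
  P n.+1 = ('X - b%:P) * P n - c *: Pprev n].
Proof.
have hpos m : 0 < L (P m * P m) by rewrite Lpos// Pneq0.
pose b := L ('X * P n * P n) / L (P n * P n).
have bE : b * L (P n * P n) = L (P n * ('X * P n)).
  by rewrite /b divfK ?gt_eqF// mulrC.
have [c c01 cE] : exists2 c : R, 0 <= c <= 1 &
    forall k, (k < n)%N -> c * L (Pprev n * P k) = L (P n * ('X * P k)).
  case: (n) => [|m]; first by exists 0; rewrite ?lexx ?ler01.
  exists (L (P m.+1 * P m.+1) / L (P m * P m)).
    by rewrite divr_ge0 ?L_sq_ge0// ler_pdivrMr// mul1r norm_nonincreasing.
  move=> k; rewrite ltnS leq_eqVlt => /predU1P[->|km] /=.
    by rewrite divfK ?gt_eqF// L_mulX_succ.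
  rewrite [X in _ * X]Porth ?gtn_eqF// mulr0 orthogonal_lower//.
  by rewrite mulrC size_mulX ?Pneq0// Psize.
exists b, c; split => //.
  by rewrite /b normrM normfV (gtr0_norm (hpos n)) ler_pdivrMr// mul1r L_mulX_bound.
apply/eqP; rewrite -subr_eq0.
set r := (X in X == 0).
have rE : r = - ('X * P n - P n.+1) + b *: P n + c *: Pprev n.
  by rewrite /r -!mul_polyC; ring.
have sr : (size r <= n.+1)%N.
  rewrite rE (leq_trans (size_polyD _ _))// geq_max; apply/andP; split.
    rewrite (leq_trans (size_polyD _ _))// geq_max size_polyN size_mulX_sub /=.
    by rewrite (leq_trans (size_scale_leq _ _))// Psize.
  exact: leq_trans (size_scale_leq _ _) (leqW (size_Pprev n)).
case: eqVneq => // /Lpos.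
rewrite (_ : L (r * r) = 0) ?ltxx//.
apply: (orthogonal_to_smaller _ n.+1) => // k kn.
have -> : r * P k = P n.+1 * P k - P n * ('X * P k) + b *: (P n * P k)
    + c *: (Pprev n * P k).
  by rewrite rE -!mul_polyC; ring.
rewrite 2!LD LB !LZ Porth ?gtn_eqF// add0r.
move: kn; rewrite ltnS leq_eqVlt => /predU1P[->|kn].
  have -> : L (Pprev n * P n) = 0.
    by rewrite mulrC orthogonal_lower// size_Pprev.
  by rewrite bE addNr mulr0 addr0.
by rewrite cE// Porth ?gtn_eqF// mulr0 addr0 addNr.
Qed.

(** Substituting the recurrence in W_(n+1) gives W_(n+1) = P_n^2 + c W_n. *)
Lemma wronskian_ge n x :
  (Pprev n).[x] ^+ 2 <= (wronskian (P n) (Pprev n)).[x].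
Proof.
rewrite /wronskian hornerD hornerN !hornerM.
elim: n => [|n IHn] /=; first by rewrite deriv0 !horner0 expr0n !mulr0 subrr.
have [b [c [_ /andP[c0 _] ->]]] := recurrence n.
rewrite !poly.derivE !hornerE /=.
rewrite subr0 mul1r -subr_ge0.
set w := (X in _ <= X) in IHn.
rewrite [X in 0 <= X](_ : _ = c * w); last by rewrite /w; ring.
by rewrite mulr_ge0// (le_trans _ IHn)// sqr_ge0.
Qed.

End OrthogonalPolynomials.

(** * A Riccati inequality bounds a ratio of polynomials *)

Section RiccatiBound.
Variable R : realType.
Implicit Types p q : {poly R}.

(** (p / q)' = wronskian p q / q^2. *)
Lemma ratio_mvt p q (a b : R) : a <= b ->
  (forall x, x \in `[a, b] -> q.[x] != 0) ->
  exists2 c, c \in `[a, b] &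
    p.[b] / q.[b] - p.[a] / q.[a] = (wronskian p q).[c] / q.[c] ^+ 2 * (b - a).
Proof.
move=> ab q0.
pose f x := p.[x] / q.[x].
pose df x := (wronskian p q).[x] / q.[x] ^+ 2.
have fd x : x \in `[a, b] -> is_derive x (1 : R) f (df x).
  move=> /q0 qx0.
  have dV := is_deriveV qx0 (is_derive_poly q x).
  apply: trigger_derive (is_deriveM (is_derive_poly p x) dV) _.
  rewrite /df /wronskian !hornerE /GRing.scale /=.
  by field.
have fdo x : x \in `]a, b[ -> is_derive x (1 : R) f (df x).
  by move=> xab; apply: fd; exact: subset_itv_oo_cc xab.
have fc : {within `[a, b], continuous f}.
  apply: derivable_within_continuous => x xab.
  exact: (@ex_derive _ _ _ _ _ _ _ (fd x xab)).
have [c cab e] := MVT_segment ab fdo fc.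
by exists c.
Qed.

(** The blow-up argument to the right of 0. If p(0) = - t q(0), then g = q / p has
g(0) = - 1 / t; it is nonincreasing, hence negative on [0, t], while its inverse
p / q has slope at least 1 and so grows from - t to a nonnegative value at t. *)
Lemma ratio_neq_right p q (d t : R) :
  (forall x, q.[x] ^+ 2 <= (wronskian p q).[x]) ->
  (forall x, x \in `]- d, d[ -> ~~ root p x) ->
  q.[0] != 0 -> 0 < t < d -> p.[0] != - t * q.[0].
Proof.
move=> Wq p0 q0 /andP[t0 td]; apply/eqP => pq.
have pn0 x : x \in `[0, t] -> p.[x] != 0.
  rewrite in_itv /= => /andP[x0 xt]; apply: p0.
  by rewrite in_itv /=; apply/andP; split; lra.
have decr x : x \in `[0, t] -> q.[x] / p.[x] <= - t^-1.
  move=> xt; have x0 : 0 <= x by move: xt; rewrite in_itv /= => /andP[].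
  have [|c cx e] := @ratio_mvt q p 0 x x0.
    move=> y; rewrite in_itv /= => /andP[y0 yx]; apply: pn0.
    by move: xt; rewrite !in_itv /= => /andP[_ xt]; rewrite y0 (le_trans yx).
  have -> : - t^-1 = q.[0] / p.[0] by rewrite pq; field; rewrite q0 gt_eqF.
  rewrite -subr_le0 e mulr_le0_ge0 ?subr_ge0//.
  rewrite mulr_le0_ge0 ?invr_ge0 ?sqr_ge0//.
  have := le_trans (sqr_ge0 _) (Wq c).
  by rewrite /wronskian !hornerE; lra.
have qn0 x : x \in `[0, t] -> q.[x] != 0.
  move=> /decr; apply: contraTneq => ->; rewrite mul0r -ltNge oppr_lt0.
  by rewrite invr_gt0.
have [c ct] := ratio_mvt p q 0 t (ltW t0) qn0.
have c1 : 1 <= (wronskian p q).[c] / q.[c] ^+ 2.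
  by rewrite ler_pdivlMr ?mul1r// exprn_even_gt0// qn0.
have -> : p.[0] / q.[0] = - t by rewrite pq mulfK.
rewrite subr0 => e.
have : 0 <= p.[t] / q.[t] by nra.
have tt : t \in `[0, t] by rewrite in_itv /= lexx ltW.
rewrite -invr_ge0 invf_div => h.
by have := le_trans h (decr _ tt); rewrite oppr_ge0 invr_le0 leNgt t0.
Qed.

(** The Wronskian inequality is invariant under (p, q) |-> (p(-x), - q(-x)), which
exchanges the two sides of 0. *)
Lemma wronskian_reflect p q x :
  (wronskian (p \Po - 'X) (- (q \Po - 'X))).[x] = (wronskian p q).[- x].
Proof.
by rewrite /wronskian derivN !deriv_comp !derivN derivX !(hornerE, horner_comp); ring.
Qed.

(** If |p(0) / q(0)| < d, one of the two points at distance |p(0) / q(0)| from 0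
contradicts [ratio_neq_right], directly or after reflection. *)
Lemma ratio_bound p q (d : R) : 0 < d ->
  (forall x, q.[x] ^+ 2 <= (wronskian p q).[x]) ->
  (forall x, x \in `]- d, d[ -> ~~ root p x) ->
  `|q.[0] / p.[0]| <= d^-1.
Proof.
move=> d0 Wq p0.
have [->|q0] := eqVneq q.[0] 0; first by rewrite mul0r normr0 invr_ge0 ltW.
have p00 : p.[0] != 0 by apply: p0; rewrite in_itv /= oppr_lt0 d0.
rewrite -invf_div normfV lef_pV2 ?posrE// ?normr_gt0 ?mulf_neq0 ?invr_neq0//.
rewrite leNgt; apply/negP => td.
set s := p.[0] / q.[0] in td.
have sE : p.[0] = s * q.[0] by rewrite /s divfK.
have : s != 0 by rewrite mulf_neq0 ?invr_neq0.
rewrite neq_lt => /orP[s0|s0].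
  have := @ratio_neq_right p q d (- s) Wq p0 q0.
  by rewrite ltr0_norm// in td; rewrite oppr_gt0 s0 td opprK -sE eqxx => /(_ isT).
have := @ratio_neq_right (p \Po - 'X) (- (q \Po - 'X)) d s.
rewrite !(hornerE, horner_comp) oppr0 oppr_eq0 mulrNN -sE eqxx s0.
rewrite gtr0_norm// in td; rewrite td => noroot.
suff : ~~ true by [].
apply: noroot => //.
- move=> x; rewrite wronskian_reflect hornerN sqrrN horner_comp hornerN hornerX; exact: Wq.
- move=> x xd; rewrite /root horner_comp; apply: p0.
  by move: xd; rewrite !in_itv /= !hornerE ltrN2 ltrNl andbC.
Qed.

End RiccatiBound.

(** * Integration of polynomials over the two intervals *)

Lemma infinite_not_root (R : idomainType) (A : set R) (p : {poly R}) : infinite_set A -> p != 0 ->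
  exists2 x, A x & ~~ root p x.
Proof.
move=> infA p0; apply: contrapT => /forall2NP noroot.
have [B BA sB] := infinite_set_fset (size p) infA.
suff : (size (enum_fset B) < size p)%N by rewrite ltnNge sB.
apply: max_poly_roots p0 _ (fset_uniq B); apply/allP => x xB.
by case: (noroot x) => [/(_ (BA _ xB))//|/negP/negbNE].
Qed.

Section PolyIntegral.
Variables (R : realType) (alpha beta : R)
  (sigma : {finite_measure set (measurableTypeR R) -> \bar R}).
Hypotheses (halpha : alpha < 1) (hbeta : -1 < beta).
Local Notation E := (two_intervals alpha beta).

Definition polyint (p : {poly R}) : R := \int[sigma]_(x in E) p.[x].

Lemma measurable_E : measurable (E : set (measurableTypeR R)).
Proof. by apply: measurableU; exact: measurable_itv. Qed.

Lemma E_norm x : E x -> `|x| <= 1.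
Proof.
case=> /=; rewrite in_itv /= => /andP[h1 h2]; rewrite ler_norml.
  by rewrite h1 (le_trans h2 (ltW halpha)).
by rewrite (le_trans (ltW hbeta) h1) h2.
Qed.

Lemma integrable_poly (p : {poly R}) :
  sigma.-integrable E (EFin \o horner p : measurableTypeR R -> \bar R).
Proof.
apply: measurable_bounded_integrable.
- exact: measurable_E.
- by rewrite ltey_eq fin_num_measure//; exact: measurable_E.
- exact: measurable_poly.
- exists (\sum_(i < size p) `|p`_i|); split; first exact: num_real.
  move=> M hM x Ex; apply: le_trans (ltW hM).
  rewrite horner_coef (le_trans (ler_norm_sum _ _ _))//; apply: ler_sum => i _.
  by rewrite normrM normrX ler_piMr// exprn_ile1// E_norm.
Qed.

Lemma polyint_scalar : scalar polyint.
Proof.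
move=> a p q; rewrite /polyint.
under eq_Rintegral do rewrite hornerD hornerZ.
rewrite RintegralD ?RintegralZl//; try exact: measurable_E; try exact: integrable_poly.
have := integrable_poly (a *: p); congr (sigma.-integrable _ _).
by apply/funext => x /=; rewrite hornerZ.
Qed.

Lemma polyint_le (p q : {poly R}) :
  (forall x, E x -> p.[x] <= q.[x]) -> polyint p <= polyint q.
Proof.
by move=> pq; apply: le_Rintegral => //; [exact: measurable_E|exact: integrable_poly..].
Qed.

Lemma polyint_contract (p : {poly R}) :
  polyint ('X * p * ('X * p)) <= polyint (p * p).
Proof.
apply: polyint_le => x Ex; rewrite !hornerM hornerX -!expr2 exprMn.
by rewrite ler_piMl ?sqr_ge0// -real_normK ?num_real// exprn_ile1// E_norm.
Qed.

Hypothesis sigma_on_E : sigma (~` E) = 0%E.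
Hypothesis sigma_inf : infinite_set (msupport sigma).

(** If the integral of p^2 vanished, the open set where p != 0 would be null, so
the support would be contained in the finite set of roots of p. *)
Lemma polyint_gt0 (p : {poly R}) : p != 0 -> 0 < polyint (p * p).
Proof.
move=> p0.
have p2ge0 x : E x -> 0 <= (p * p).[x] by rewrite hornerM -expr2 sqr_ge0.
rewrite lt_def Rintegral_ge0// andbT; apply/eqP => I0.
have int0 : (\int[sigma]_(x in E) `|((p * p).[x])%:E| = 0)%E.
  rewrite (eq_integral (fun x : measurableTypeR R => ((p * p).[x])%:E)).
    have /integrable_fin_num : sigma.-integrable E
      (EFin \o horner (p * p) : measurableTypeR R -> \bar R) by exact: integrable_poly.
    by move=> /(_ measurable_E)/fineK <-; rewrite -[LHS]/((polyint (p * p))%:E) I0.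
  by move=> x /set_mem /p2ge0 h; rewrite gee0_abs ?lee_fin.
move/ae_eq_integral_abs : int0 => /(_ measurable_E) [|A [mA A0 subA]].
  by apply/measurable_EFinP; exact: measurable_poly.
have [x suppx px] := infinite_not_root _ (msupport sigma) p sigma_inf p0.
pose U := [set y : R | p.[y] != 0].
have oU : open U.
  apply: (@open_comp _ _ (horner p) [set y | y != 0]).
    by move=> y _; exact: continuous_horner.
  exact: open_neq.
have := suppx U (conj oU px).
rewrite ltNge; apply/negP/negPn.
have mU : measurable (U : set (measurableTypeR R)) by exact: open_measurable.
have mE := measurable_E.
have UA : (U `<=` A `|` ~` E).
  move=> y Uy; have [Ey|] := pselect (E y); last by right.
  left; apply: subA => /= /(_ Ey) [].
  by move/eqP; rewrite hornerM mulf_eq0 (negPf Uy).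
have mAE := measurableU _ _ mA (measurableC mE).
apply: le_trans (le_measure sigma (mem_set mU) (mem_set mAE) UA) _.
have := @measureU2 _ _ _ sigma _ _ mA (measurableC mE).
by rewrite [X in (X + _)%E]A0 [X in (_ + X)%E]sigma_on_E adde0.
Qed.

End PolyIntegral.

(** * Boundedness of the ratios at 0 *)

Theorem proposition5p7 (R : realType) (alpha beta : R)
    (halpha : -1 < alpha < 0) (hbeta : 0 < beta < 1)
    (sigma : {finite_measure set (measurableTypeR R) -> \bar R})
    (sigma_on_E : sigma (~` two_intervals alpha beta) = 0%E)
    (sigma_inf : infinite_set (msupport sigma))
    (P : nat -> {poly R})
    (hP : monic_orthogonal sigma (two_intervals alpha beta) P)
    (j : nat -> nat) (hj : increasing_seq j)
    (hzeros : accumulation_free0 (fun k => P (j k))) :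
  bounded_fun (fun k : nat => (P (j k).+1).[0] / (P (j k)).[0]).
Proof.
have [Pmonic Psize Porth] := hP.
have [alpha1 beta1] : alpha < 1 /\ -1 < beta by split; lra.
pose L : {scalar {poly R}} := HB.pack (polyint R alpha beta sigma)
  (GRing.isLinear.Build R {poly R} R *%R _
    (polyint_scalar _ _ _ sigma alpha1 beta1)).
have Lpos (p : {poly R}) : p != 0 -> 0 < L (p * p).
  exact: polyint_gt0.
have Lcontract (p : {poly R}) : L ('X * p * ('X * p)) <= L (p * p).
  exact: polyint_contract.
have LPorth m n : m != n -> L (P m * P n) = 0.
  move=> /Porth mn; rewrite /L /= /polyint /Rintegral.
  by under eq_integral do rewrite hornerM; rewrite mn.
have [d d0 noroot] := hzeros.
exists (1 + d^-1); split; first exact: num_real.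
move=> M hM k _ /=; apply: le_trans (ltW hM).
have Pk0 : (P (j k)).[0] != 0.
  by apply: noroot; rewrite in_itv /= oppr_lt0 d0.
have [b [c [b1 /andP[c0 c1] ->]]] :=
  recurrence _ _ _ Lpos Lcontract Pmonic Psize LPorth (j k).
have g1 := ratio_bound _ _ _ _ d0
  (wronskian_ge _ _ _ Lpos Lcontract Pmonic Psize LPorth (j k)) (noroot k).
set q := Pprev _ _ _ in g1 *.
have -> : (('X - b%:P) * P (j k) - c *: q).[0] / (P (j k)).[0] =
    - b - c * (q.[0] / (P (j k)).[0]).
  by rewrite hornerD hornerN hornerM hornerXsubC hornerZ; field.
rewrite (le_trans (ler_normB _ _))// normrN lerD// normrM ger0_norm//.
by rewrite -[leRHS]mul1r ler_pM.
Qed.
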